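(* Let $(X,d)$ be a metric space, let $M$ be a closed nonempty proper subset of $X$, let $F:(X\setminus M,d)\to(0,\infty)$ be a $1$-Lipschitz function, and let $i$ be the metric on $X\setminus M$ defined by $$i(x,y)=2\log\frac{F(x)+F(y)+d(x,y)}{2\sqrt{F(x)F(y)}},\qquad x,y\in X\setminus M.$$ Then the identity map $1_{X\setminus M}:(X\setminus M,d)\to(X\setminus M,i)$ is $3$-quasiconformal.
   Context: $\log$ is the natural logarithm. $F$ is $1$-Lipschitz if $|F(x)-F(y)|\le d(x,y)$ for all $x,y\in X\setminus M$. The function $i$ is a metric on $X\setminus M$. For a homeomorphism $f:(Y,\rho)\to(Z,\sigma)$ between metric spaces, $x\in Y$ and $r>0$, set $$H_f(x,r)=\frac{\sup\{\sigma(f(x),f(y)):y\in Y,\ \rho(x,y)\le r\}}{\inf\{\sigma(f(x),f(y)):y\in Y,\ \rho(x,y)\ge r\}}$$ (with $\inf\emptyset=+\infty$, and the quotient understood as $0$ in that case when the numerator is finite). For a constant $0\le H<\infty$, a map $f:(Y,\rho)\to(Z,\sigma)$ is $H$-quasiconformal if it is a homeomorphism and $\limsup_{r\to0}H_f(x,r)\le H$ for every $x\in Y$. *)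

(* Defs.v *)
(* MathComp-Analysis: metric spaces are [metricType R] over an abstract
   [R : realType], with distance [mdist]; [metricType] does not require a point. *)
From HB Require Import structures.
From mathcomp Require Import all_boot all_order all_algebra.
From mathcomp Require Import all_classical all_reals all_analysis.
From mathcomp Require Import ring lra.

Set Implicit Arguments.
Unset Strict Implicit.
Unset Printing Implicit Defensive.

Import Order.TTheory GRing.Theory Num.Theory.
Import numFieldNormedType.Exports.

Local Open Scope classical_set_scope.
Local Open Scope ring_scope.

(* The library already gives the type of points of [A : set X] the induced
   pseudometric; its balls come from the restricted distance below. *)
Section subset_metric.
Context {R : realType} {X : metricType R} (A : set X).

Let sub_dist (x y : A) : R := mdist (set_val x) (set_val y).

Let sub_dist_ge0 (x y : A) : 0 <= sub_dist x y.
Proof. exact: mdist_ge0. Qed.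

Let sub_dist_positivity (x y : A) : sub_dist x y = 0 -> x = y.
Proof. by move=> /mdist_positivity; exact: val_inj. Qed.

Let ballEsub_dist (x : A) (d : R) : ball x d = [set y | sub_dist x y < d].
Proof. by rewrite -initial_ballE ballEmdist. Qed.

HB.instance Definition _ := PseudoMetric_isMetric.Build R (set_type A)
  sub_dist_ge0 sub_dist_positivity ballEsub_dist.

Lemma mdist_subE (x y : A) : mdist x y = mdist (set_val x) (set_val y).
Proof. by []. Qed.

End subset_metric.

Definition lipschitz1 {R : realType} {T : metricType R} (F : T -> R) :=
  forall x y, `|F x - F y| <= mdist x y.

Definition i_dist {R : realType} {T : metricType R} (F : T -> R) (x y : T) : R :=
  2 * ln ((F x + F y + mdist x y) / (2 * Num.sqrt (F x * F y))).

(* [i_space F_gt0 F_lip] is a copy of [T] carrying the metric [i_dist F]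
   (and the topology of that metric) instead of [mdist]. *)
Definition i_space {R : realType} {T : metricType R} {F : T -> R}
  of (forall x, 0 < F x) & lipschitz1 F : Type := T.

Section i_metric.
Context {R : realType} {T : metricType R} {F : T -> R}.
Variables (F_gt0 : forall x, 0 < F x) (F_lip : lipschitz1 F).

Let num_gt0 x y : 0 < F x + F y + mdist x y.
Proof. by rewrite ltr_wpDr ?mdist_ge0// addr_gt0. Qed.

Let den_gt0 x y : 0 < 2 * Num.sqrt (F x * F y).
Proof. by rewrite mulr_gt0// sqrtr_gt0 mulr_gt0. Qed.

Let quo_gt0 x y : 0 < (F x + F y + mdist x y) / (2 * Num.sqrt (F x * F y)).
Proof. exact: divr_gt0. Qed.

Let i_distxx x : i_dist F x x = 0.
Proof.
rewrite /i_dist mdistxx addr0 -expr2 sqrtr_sqr gtr0_norm//.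
have -> : F x + F x = 2 * F x by ring.
by rewrite divff ?ln1 ?mulr0// gt_eqF// mulr_gt0.
Qed.

Let i_dist_positivity x y : i_dist F x y = 0 -> x = y.
Proof.
move=> /eqP; rewrite mulf_eq0 pnatr_eq0/= ln_eq0// => /eqP e.
have {}e : F x + F y + mdist x y = 2 * Num.sqrt (F x * F y).
  exact: divr1_eq.
apply/mdist_positivity/eqP; rewrite eq_le mdist_ge0 andbT.
have sx := sqr_sqrtr (ltW (F_gt0 x)).
have sy := sqr_sqrtr (ltW (F_gt0 y)).
move: e; rewrite (sqrtrM _ (ltW (F_gt0 x))) -[in F x + _]sx -[in _ + F y]sy.
move: (Num.sqrt (F x)) (Num.sqrt (F y)) (mdist x y) => a b d e.
have -> : d = (a ^+ 2 + b ^+ 2 + d) - a ^+ 2 - b ^+ 2 by ring.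
rewrite e (_ : _ - _ = - (a - b) ^+ 2); last by ring.
by rewrite oppr_le0 sqr_ge0.
Qed.

Let i_dist_sym x y : i_dist F x y = i_dist F y x.
Proof. by rewrite /i_dist metric_sym (addrC (F x)) (mulrC (F x)). Qed.

Let i_dist_triangle y x z : i_dist F x z <= i_dist F x y + i_dist F y z.
Proof.
rewrite /i_dist -mulrDr ler_pM2l// -lnM ?posrE//.
rewrite ler_ln ?posrE; [|exact: quo_gt0|by rewrite mulr_gt0 ?quo_gt0].
rewrite mulf_div ler_pdivrMr// mulrAC ler_pdivlMr; last first.
  exact: mulr_gt0.
have sy : F y = Num.sqrt (F y) ^+ 2 by rewrite sqr_sqrtr// ltW.
have -> : 2 * Num.sqrt (F x * F y) * (2 * Num.sqrt (F y * F z)) =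
          2 * F y * (2 * Num.sqrt (F x * F z)).
  by rewrite !sqrtrM ?ltW// [X in _ = 2 * X * _]sy; ring.
rewrite mulrA ler_pM2r//.
have /ler_normlP[xy1 xy2] := F_lip x y.
have /ler_normlP[yz1 yz2] := F_lip y z.
have xz := metric_triangle x y z.
have yg := F_gt0 y.
apply: (@le_trans _ _ ((F x + F z + (mdist x y + mdist y z)) * (2 * F y))).
  by rewrite ler_wpM2r ?lerD2l// mulr_ge0// ltW.
have h1 : 0 <= F x - F y + mdist x y by lra.
have h2 : 0 <= F z - F y + mdist y z by lra.
rewrite -subr_ge0.
rewrite (_ : _ - _ = (F x - F y + mdist x y) * (F z - F y + mdist y z)).
  exact: mulr_ge0.
by ring.
Qed.

HB.instance Definition _ := Choice.copy (i_space F_gt0 F_lip) T.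
HB.instance Definition _ := @isMetric.Build R (i_space F_gt0 F_lip)
  (i_dist F) i_distxx i_dist_positivity i_dist_sym i_dist_triangle.

Definition to_i_space : T -> i_space F_gt0 F_lip := id.

Lemma mdist_iE (x y : i_space F_gt0 F_lip) : mdist x y = i_dist F x y.
Proof. by []. Qed.

End i_metric.

Arguments to_i_space {R T F} F_gt0 F_lip.

Definition homeomorphism {Y Z : topologicalType} (f : Y -> Z) :=
  exists g : Z -> Y, [/\ cancel f g, cancel g f, continuous f & continuous g].

Section quasiconformal.
Context {R : realType} {Y Z : metricType R}.
Local Open Scope ereal_scope.

(* In [\bar R], [ereal_inf set0 = +oo] and [a / +oo = 0]. The library also sets
   [+oo / +oo = 0] and [0 / 0 = 0]; neither case occurs for small [r > 0] when
   [f] is a homeomorphism: the numerator is then finite by continuity of [f]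
   and the denominator positive by continuity of its inverse. *)
Definition dilatation (f : Y -> Z) (x : Y) (r : R) : \bar R :=
  ereal_sup [set (mdist (f x) (f y))%:E | y in [set y | (mdist x y <= r)%R]] /
  ereal_inf [set (mdist (f x) (f y))%:E | y in [set y | (r <= mdist x y)%R]].

Definition quasiconformal (H : R) (f : Y -> Z) :=
  [/\ (0 <= H)%R, homeomorphism f &
      forall x, limf_esup (dilatation f x) 0%R^'+ <= H%:E].

End quasiconformal.

(* Main.v *)
Require Import Defs.
From mathcomp Require Import all_boot all_order all_algebra.
From mathcomp Require Import all_classical all_reals all_analysis.
From mathcomp Require Import ring lra.

Import Order.TTheory GRing.Theory Num.Theory.
Import numFieldNormedType.Exports.

Local Open Scope classical_set_scope.
Local Open Scope ring_scope.

(** On a sphere of radius [t] about [x], with [a = F x], the distance [i]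
    varies little.  Write [b = F y]; then [i x y = ln ((a + b + t)^2 / (4ab))],
    and the Lipschitz condition confines [b] to [[a - t, a + t]].  The argument
    of the logarithm is smallest at [b = a + t], where it equals [(a + t) / a],
    and largest at [b = a - t], where it equals [a / (a - t)].  By
    [ln u <= u - 1] this gives
    [[
      t / (a + t) <= i x y <= t / (a - t),
    ]]
    the upper bound for [t < a] ([i_dist_ge] and [i_dist_le]).

    Both bounds are increasing in [t] and vanish at [0], so [d] and [i] have the
    same topology, and the dilatation at radius [r < a] is at most
    [(r / (a - r)) / (r / (a + r)) = (a + r) / (a - r)] ([dilatation_i_le]).
    This is at most [3] as soon as [r <= a / 2]. *)

Section i_dist_bounds.
Context {R : realType} {T : metricType R} {F : T -> R}.
Hypothesis F_gt0 : forall x, 0 < F x.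

(** Squaring under the logarithm removes the square root. *)
Lemma i_dist_ln (x y : T) :
  i_dist F x y = ln ((F x + F y + mdist x y) ^+ 2 / (4 * F x * F y)).
Proof.
have Fx := F_gt0 x; have Fy := F_gt0 y.
rewrite /i_dist mulr_natl -lnXn; last first.
  rewrite divr_gt0 ?mulr_gt0 ?sqrtr_gt0 ?mulr_gt0//.
  by rewrite ltr_wpDr ?mdist_ge0// addr_gt0.
congr ln; rewrite expr_div_n exprMn sqr_sqrtr ?mulr_ge0 ?ltW//.
by congr (_ / _); ring.
Qed.

(** The lower bound amounts to [(a + t - b)^2 >= 0]. *)
Lemma i_dist_ge (x y : T) :
  mdist x y / (F x + mdist x y) <= i_dist F x y.
Proof.
have Fx := F_gt0 x; have Fy := F_gt0 y; have t0 := mdist_ge0 x y.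
rewrite i_dist_ln.
move: (F x) (F y) (mdist x y) Fx Fy t0 => a b t a0 b0 t0.
have at0 : 0 < a + t by lra.
apply: (@le_trans _ _ (ln ((a + t) / a))).
  (* [ln u <= u - 1] at the inverse [u = a / (a + t)] *)
  have u0 : 0 < a / (a + t) by rewrite divr_gt0.
  have := @le_ln1Dx R (a / (a + t) - 1).
  rewrite (_ : 1 + _ = a / (a + t)); last by ring.
  rewrite -[(a + t) / a]invf_div lnV ?posrE// => /(_ _).
  rewrite (_ : t / (a + t) = - (a / (a + t) - 1)); last by field; lra.
  by rewrite lerN2; apply; lra.
rewrite ler_ln ?posrE ?divr_gt0 ?exprn_gt0 ?mulr_gt0//; last by lra.
rewrite ler_pdivlMr ?mulr_gt0// -subr_ge0.
rewrite (_ : _ - _ = (a + t - b) ^+ 2) ?sqr_ge0//.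
by field; lra.
Qed.

Hypothesis F_lip : lipschitz1 F.

(** As a polynomial in [b], the difference of the two sides of
    [(a + b + t)^2 (a - t) <= 4 a^2 b] factors with roots [a - t] and
    [(a + t)^2 / (a - t)], and [b] lies between them. *)
Lemma i_dist_le (x y : T) : mdist x y < F x ->
  i_dist F x y <= mdist x y / (F x - mdist x y).
Proof.
have Fx := F_gt0 x; have Fy := F_gt0 y; have t0 := mdist_ge0 x y.
have /ler_normlP[] := F_lip x y.
rewrite i_dist_ln.
move: (F x) (F y) (mdist x y) Fx Fy t0 => a b t a0 b0 t0 ab1 ab2 ta.
have at0 : 0 < a - t by lra.
apply: (@le_trans _ _ (ln (a / (a - t)))); last first.
  have u0 : 0 < a / (a - t) by rewrite divr_gt0.
  have := @le_ln1Dx R (a / (a - t) - 1).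
  rewrite (_ : 1 + _ = a / (a - t)); last by ring.
  rewrite (_ : t / (a - t) = a / (a - t) - 1); last by field; lra.
  by apply; lra.
rewrite ler_ln ?posrE ?divr_gt0 ?exprn_gt0 ?mulr_gt0//; last by lra.
rewrite ler_pdivrMr ?mulr_gt0// mulrAC ler_pdivlMr// -subr_ge0.
rewrite (_ : _ - _ = (b - (a - t)) * ((a + t) ^+ 2 - b * (a - t))); last by ring.
by rewrite mulr_ge0//; nra.
Qed.

Lemma to_i_space_continuous : continuous (to_i_space F_gt0 F_lip).
Proof.
move=> x; apply/cvg_ballP => e e0.
have a0 := F_gt0 x.
(* the [t] for which [t / (F x - t) = e] *)
have d0 : 0 < e * F x / (1 + e) by rewrite divr_gt0 ?mulr_gt0//; lra.
apply: filterS (nbhsx_ballx x _ d0) => y.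
rewrite !ballEmdist/= mdist_iE ltr_pdivlMr; last by lra.
have t0 := mdist_ge0 x y => te.
have ta : mdist x y < F x by nra.
apply: le_lt_trans (i_dist_le _ _ ta) _.
by rewrite ltr_pdivrMr; lra.
Qed.

Lemma of_i_space_continuous : continuous (id : i_space F_gt0 F_lip -> T).
Proof.
move=> x; apply/(@cvg_ballP _ T _ _ (nbhs_filter x)) => e e0.
have a0 := F_gt0 x.
(* [e / (F x + e)] bounds [i x y] from below when [d x y >= e] *)
have d0 : 0 < e / (F x + e) by rewrite divr_gt0//; lra.
apply: filterS (nbhsx_ballx x _ d0) => y.
rewrite !ballEmdist/= mdist_iE => /(le_lt_trans (i_dist_ge x y)).
have t0 := @mdist_ge0 R T x y.
rewrite ltr_pdivrMr; last by lra.
rewrite mulrAC ltr_pdivlMr; last by lra.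
by nra.
Qed.

Lemma to_i_space_homeomorphism : homeomorphism (to_i_space F_gt0 F_lip).
Proof.
exists id; split => //.
- exact: to_i_space_continuous.
- exact: of_i_space_continuous.
Qed.

Local Open Scope ereal_scope.

(** By monotonicity in [t] of the two bounds on [i], the supremum over
    [t <= r] and the infimum over [t >= r] are controlled by their values
    at [t = r]. *)
Lemma dilatation_i_le (x : T) (r : R) : (0 < r < F x)%R ->
  dilatation (to_i_space F_gt0 F_lip) x r <= ((F x + r) / (F x - r))%:E.
Proof.
move=> /andP[r0 ra]; have a0 := F_gt0 x.
rewrite /dilatation.
set S := ereal_sup _; set I := ereal_inf _.
have S_le : S <= (r / (F x - r))%:E.
  apply: ge_ereal_sup => _ [y /= tr <-].
  have t0 := mdist_ge0 x y.
  rewrite lee_fin mdist_iE; apply: le_trans (i_dist_le _ _ _) _; first by lra.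
  rewrite ler_pdivrMr; last by lra.
  rewrite mulrAC ler_pdivlMr; last by lra.
  by nra.
have I_ge : (r / (F x + r))%:E <= I.
  apply: le_ereal_inf_tmp => _ [y /= tr <-].
  rewrite lee_fin mdist_iE; apply: le_trans (i_dist_ge _ _).
  rewrite ler_pdivrMr; last by lra.
  rewrite mulrAC ler_pdivlMr; last by lra.
  by nra.
have q0 : (0 < r / (F x + r))%R by rewrite divr_gt0//; lra.
move: I I_ge => [i||]//.
- rewrite lee_fin => qi.
  have i0 := lt_le_trans q0 qi.
  rewrite inver gt_eqF// lee_pdivrMr//; apply: le_trans S_le _.
  rewrite lee_fin.
  apply: (@le_trans _ _ ((F x + r) / (F x - r) * (r / (F x + r)))%R).
    by rewrite le_eqVlt; apply/orP; left; apply/eqP; field; lra.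
  by rewrite ler_wpM2l// divr_ge0//; lra.
(* no point lies at distance at least [r] from [x] *)
- by rewrite invey mule0 lee_fin divr_ge0//; lra.
Qed.

Lemma to_i_space_quasiconformal : quasiconformal 3 (to_i_space F_gt0 F_lip).
Proof.
split => [//||x]; first exact: to_i_space_homeomorphism.
have a0 := F_gt0 x.
pose V : set R := [set r | 0 < r <= F x / 2]%R.
apply: (@le_trans _ _
  (ereal_sup (dilatation (to_i_space F_gt0 F_lip) x @` V))).
  apply: ereal_inf_lbound; exists V => //.
  near=> r; apply/andP; split => //.
  near: r; apply: nbhs_right_le; lra.
apply: ge_ereal_sup => _ [r /andP[r0 ra] <-].
apply: le_trans (dilatation_i_le _ _ _) _; first by apply/andP; split => //; lra.
by rewrite lee_fin ler_pdivrMr; lra.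
Unshelve. all: by end_near.
Qed.

End i_dist_bounds.

Theorem theorem15 (R : realType) (X : metricType R) (M : set X)
    (M_closed : closed M) (M_neq0 : M !=set0) (M_proper : M `<` [set: X])
    (F : ~` M -> R) (F_gt0 : forall x, 0 < F x) (F_lip : lipschitz1 F) :
  quasiconformal 3 (to_i_space F_gt0 F_lip).
Proof. exact: to_i_space_quasiconformal. Qed.
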